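(* Let $G$ be an AH-algebra (the directed group of an e-ring $(R,E)$) and let $H$ be a C-block in $G$. Then: (i) If $h\in H$, then $|h|,\,h^{+},\,h^{-},\,h^{\mathrm o}\in H$. (ii) $H$ is an archimedean Dedekind $\sigma$-complete $\ell$-algebra with order unit $1$. (iii) If $g,h\in H$, then the infimum and supremum of $g$ and $h$ in $H$ are given by $g\wedge_H h=g-(g-h)^{+}$ and $g\vee_H h=g+(h-g)^{+}$. (iv) If $h\in H$, then the spectral resolution and the family of eigenprojections of $h$ are the same whether calculated in $G$ or in $H$.
   Context: **e-rings.** An e-ring is a pair $(R,E)$ where $R$ is an associative ring with unity $1\neq 0$ and $E\subseteq R$ is a subset (elements called effects) such that $0,1\in E$; $e\in E\Rightarrow 1-e\in E$; and the set $E^{+}$ of all finite sums $e_1+\cdots+e_n$ with $e_i\in E$ satisfies, for all $a,b\in E^{+}$: (i) $-a\in E^{+}\Rightarrow a=0$; (ii) $1-a\in E^{+}\Rightarrow a\in E$; (iii) $ab=ba\Rightarrow ab\in E^{+}$; (iv) $aba\in E^{+}$; (v) $aba=0\Rightarrow ab=ba=0$; (vi) $(a-b)^2\in E^{+}$. The directed group of $(R,E)$ is $G:=E^{+}-E^{+}=\{a-b: a,b\in E^{+}\}$, a subgroup of the additive group of $R$, partially ordered by $g\leq h\Leftrightarrow h-g\in E^{+}$. The set of projections is $P:=\{p\in G: p=p^2\}$. Products of elements of $G$ are taken in $R$. **Commutants.** For $g,h\in G$, $gCh$ means $gh=hg$. For $A\subseteq G$, $C(A):=\{g\in G: gCa\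 \forall a\in A\}$ and $CC(A):=C(C(A))$. **AH-algebra.** $G$ is an AH-algebra iff: (1) there is an effect $\frac12\in E$ with $\frac12+\frac12=1$; (2) quadratic annihilation (QA): for all $g,h\in G$, $gh^2g=0\Rightarrow gh=hg=0$; (3) commutative Vigier (CV) property: every ascending sequence $g_1\leq g_2\leq\cdots$ of pairwise commuting elements of $G$ that is bounded above in $G$ has a supremum $g$ in $G$, and $g\in CC(\{g_n:n\in\mathbb N\})$. An AH-algebra $G$ is always regarded as an archimedean partially ordered real vector space (it admits a compatible real vector space structure extending its ordered group structure, with $0\le\lambda$ and $0\le g$ implying $0\le\lambda g$; with the product $\frac12(gh+hg)$ it is a real Jordan algebra). **Notation in an AH-algebra.** For $0\leq g\in G$, $g^{1/2}$ is the unique element of $G$ with $0\leq g^{1/2}$ and $(g^{1/2})^2=g$ (it exists); $|g|:=(g^2)^{1/2}$, $g^{+}:=\frac12(|g|+g)$, $g^{-}:=\frac12(|g|-g)$ for any $g\in G$. The carrier projection $g^{\mathrm o}$ of $g\in G$ is the unique projection in $P$ such that for all $h\in G$, $gh=0\Leftrightarrow g^{\mathrm o}h=0$ (it exists). The spectral resolution of $g$ is the family $p_{g,\lambda}:=1-((g-\lambda\cdot 1)^{+})^{\mathrm o}$, and the family of eigenprojections is $d_{g,\lambda}:=1-(g-\lambda\cdot 1)^{\mathrm o}$, $\lambda\in\mathbb R$. **Blocks and C-blocks.** In an AH-algebra, $P$ is an orthomodular lattice with orthocomplementation $p\mapsto 1-p$, and two projections are (Mackey) compatible iff they commute. A block of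 $P$ is a maximal set of pairwise compatible elements of $P$; equivalently, a subset $B\subseteq P$ with $B=C(B)\cap P$. A C-block in $G$ is a subgroup of $G$ of the form $C(B)$ where $B$ is a block in $P$. A C-block $H$ is itself an AH-algebra, being the directed group of the e-ring $(R,E\cap H)$, with the order induced from $G$; it is closed under multiplication in $R$ and under multiplication by real scalars, and ''calculated in $H$'' refers to this AH-algebra structure. **Ordered algebra terms.** A real linear algebra $\mathcal A$ is a partially ordered linear algebra iff its additive group is a partially ordered abelian group and $0\leq a,b\in\mathcal A$, $0\leq\lambda\in\mathbb R$ imply $0\leq ab$ and $0\leq\lambda a$; it is an $\ell$-algebra if in addition it is a lattice. A partially ordered abelian group is archimedean iff whenever $ng\leq h$ for all positive integers $n$, then $g\leq 0$; it is Dedekind $\sigma$-complete iff every nonempty countable subset bounded above has a supremum (and dually); $1$ is an order unit iff every element $g$ satisfies $g\leq n\cdot 1$ for some positive integer $n$. *)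

(* Defs.v *)
From mathcomp Require Export all_boot all_order all_algebra.
From mathcomp Require Export boolp classical_sets cardinality reals.
Set Implicit Arguments.
Unset Strict Implicit.
Unset Printing Implicit Defensive.
Import Order.TTheory GRing.Theory Num.Theory.
Local Open Scope classical_set_scope.
Local Open Scope ring_scope.

(* The groups G and H live inside an ambient ring R: they are sets A : set R,
   and relations and operations on R are only meaningful on members of A. *)

Section OrderedStructures.
Variables (K : realType) (R : nzRingType).
Implicit Types (A S : set R) (le : R -> R -> Prop) (scal : K -> R -> R).

Definition sup_in A le S (x : R) : Prop :=
  [/\ A x, forall s, S s -> le s x
    & forall y, A y -> (forall s, S s -> le s y) -> le x y].

Definition inf_in A le S (x : R) : Prop :=
  [/\ A x, forall s, S s -> le x s
    & forall y, A y -> (forall s, S s -> le y s) -> le y x].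

Definition additive_subgroup A : Prop :=
  A 0 /\ forall x y, A x -> A y -> A (x - y).

Record po_abelian_group A le : Prop := POAbelianGroup {
  pog_subgroup : additive_subgroup A;
  pog_refl : forall x, A x -> le x x;
  pog_anti : forall x y, A x -> A y -> le x y -> le y x -> x = y;
  pog_trans : forall x y z, A x -> A y -> A z -> le x y -> le y z -> le x z;
  pog_add : forall x y z, A x -> A y -> A z -> le x y -> le (x + z) (y + z)
}.

Record real_vector_space A scal : Prop := RealVectorSpace {
  rvs_subgroup : additive_subgroup A;
  rvs_closed : forall a x, A x -> A (scal a x);
  rvs_scalA : forall a b x, A x -> scal a (scal b x) = scal (a * b) x;
  rvs_scal1 : forall x, A x -> scal 1 x = x;
  rvs_scalDr : forall a x y, A x -> A y ->
    scal a (x + y) = scal a x + scal a y;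
  rvs_scalDl : forall a b x, A x -> scal (a + b) x = scal a x + scal b x
}.

Record po_real_vector_space A le scal : Prop := PORealVectorSpace {
  porvs_group : po_abelian_group A le;
  porvs_space : real_vector_space A scal;
  porvs_scal_ge0 : forall a x, A x -> 0 <= a -> le 0 x -> le 0 (scal a x)
}.

(* The product is that of R, so associativity, distributivity and the unit law
   for 1 come for free. *)
Record real_linear_algebra A scal : Prop := RealLinearAlgebra {
  rla_space : real_vector_space A scal;
  rla_one : A 1;
  rla_mul : forall x y, A x -> A y -> A (x * y);
  rla_scalAl : forall a x y, A x -> A y -> scal a x * y = scal a (x * y);
  rla_scalAr : forall a x y, A x -> A y -> x * scal a y = scal a (x * y)
}.

Record po_linear_algebra A le scal : Prop := POLinearAlgebra {
  pola_algebra : real_linear_algebra A scal;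
  pola_space : po_real_vector_space A le scal;
  pola_mul_ge0 : forall x y, A x -> A y -> le 0 x -> le 0 y -> le 0 (x * y)
}.

Definition lattice_ordered A le : Prop :=
  forall x y, A x -> A y ->
    (exists z, sup_in A le [set x; y] z) /\ (exists z, inf_in A le [set x; y] z).

Definition l_algebra A le scal : Prop :=
  po_linear_algebra A le scal /\ lattice_ordered A le.

Definition archimedean A le : Prop :=
  forall g h, A g -> A h -> (forall n : nat, (0 < n)%N -> le (g *+ n) h) ->
    le g 0.

Definition dedekind_sigma_complete A le : Prop :=
  (forall S, S `<=` A -> S !=set0 -> countable S ->
     (exists2 b, A b & forall s, S s -> le s b) -> exists x, sup_in A le S x) /\
  (forall S, S `<=` A -> S !=set0 -> countable S ->
     (exists2 b, A b & forall s, S s -> le b s) -> exists x, inf_in A le S x).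

Definition order_unit A le (u : R) : Prop :=
  A u /\ forall g, A g -> exists2 n : nat, (0 < n)%N & le g (u *+ n).

End OrderedStructures.

Section ERing.
Variable R : nzRingType.
Implicit Types (E A B H : set R).

(* The empty sum is 0, which is an effect anyway. *)
Definition Eplus E : set R :=
  [set x | exists n (e : 'I_n -> R), (forall i, E (e i)) /\ x = \sum_i e i].

Record e_ring E : Prop := ERing {
  ering_0 : E 0;
  ering_1 : E 1;
  ering_compl : forall e, E e -> E (1 - e);
  ering_i : forall a, Eplus E a -> Eplus E (- a) -> a = 0;
  ering_ii : forall a, Eplus E a -> Eplus E (1 - a) -> E a;
  ering_iii : forall a b, Eplus E a -> Eplus E b -> a * b = b * a ->
    Eplus E (a * b);
  ering_iv : forall a b, Eplus E a -> Eplus E b -> Eplus E (a * b * a);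
  ering_v : forall a b, Eplus E a -> Eplus E b -> a * b * a = 0 ->
    a * b = 0 /\ b * a = 0;
  ering_vi : forall a b, Eplus E a -> Eplus E b -> Eplus E ((a - b) ^+ 2)
}.

Definition dirgroup E : set R :=
  [set g | exists a b, [/\ Eplus E a, Eplus E b & g = a - b]].

Definition ele E (g h : R) : Prop := Eplus E (h - g).

Definition projections E : set R := [set p | dirgroup E p /\ p = p ^+ 2].

Definition commutant E A : set R :=
  [set g | dirgroup E g /\ forall a, A a -> GRing.comm g a].

Definition bicommutant E A : set R := commutant E (commutant E A).

Definition quadratic_annihilation E : Prop :=
  forall g h, dirgroup E g -> dirgroup E h -> g * h ^+ 2 * g = 0 ->
    g * h = 0 /\ h * g = 0.

Definition commutative_vigier E : Prop :=
  forall u : nat -> R,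
    (forall n, dirgroup E (u n)) ->
    (forall n, ele E (u n) (u n.+1)) ->
    (forall m n, GRing.comm (u m) (u n)) ->
    (exists2 b, dirgroup E b & forall n, ele E (u n) b) ->
    exists g, sup_in (dirgroup E) (ele E) (range u) g /\
              bicommutant E (range u) g.

Record AH_algebra E : Prop := AHAlgebra {
  AH_half : exists2 e, E e & e + e = 1;
  AH_QA : quadratic_annihilation E;
  AH_CV : commutative_vigier E
}.

Definition is_block E B : Prop :=
  let compatible_set S :=
    S `<=` projections E /\ (forall p q, S p -> S q -> GRing.comm p q) in
  compatible_set B /\ forall B', compatible_set B' -> B `<=` B' -> B' = B.

Definition C_block E H : Prop :=
  exists B, is_block E B /\ H = commutant E B.

(* The functions below use [xget 0] for objects that exist and are unique in an
   AH-algebra; otherwise the value is arbitrary. Everything is a function of E,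
   so that notions calculated in a C-block H are those of the effects E `&` H. *)

Definition esqrt E (g : R) : R :=
  xget 0 [set s | [/\ dirgroup E s, ele E 0 s & s ^+ 2 = g]].

Definition eabs E (g : R) : R := esqrt E (g ^+ 2).

Definition carrier E (g : R) : R :=
  xget 0 [set p | projections E p /\
                  forall h, dirgroup E h -> (g * h = 0 <-> p * h = 0)].

Variables (K : realType) (scal : K -> R -> R).

Definition epos E (g : R) : R := scal 2^-1 (eabs E g + g).

Definition eneg E (g : R) : R := scal 2^-1 (eabs E g - g).

Definition spectral_resolution E (g : R) (l : K) : R :=
  1 - carrier E (epos E (g - scal l 1)).

Definition eigenprojections E (g : R) (l : K) : R :=
  1 - carrier E (g - scal l 1).

End ERing.

(* Main.v *)
(* For 0 <= g <= 1 and b = 1 - g, the iterates y_(n+1) = (b + y_n^2)/2 (with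
   limit 1 - g^(1/2)) and the elements 1 - b^n are ascending commuting sequences,
   so the commutative Vigier property provides square roots and carriers lying in
   the bicommutant of g.  The carrier of g^+ then separates the positive from the
   negative part of g; applied to g - 1/2 it yields the first binary digit of
   0 <= g <= 1.  Iterating, g = sum_i 2^-i p_i with projections p_i in the
   bicommutant of g, so an element commuting with those projections commutes with
   g.  When g lies in C(B), they belong to the block B by maximality; hence C(B) is
   commutative, and it is closed under joins, suprema and carriers because these
   lie in bicommutants of subsets of C(B). *)
From Stdlib Require Import Ncring Ncring_tac.
Require Import Defs.
Set Implicit Arguments.
Unset Strict Implicit.
Unset Printing Implicit Defensive.
Import Order.TTheory GRing.Theory Num.Theory.
Local Open Scope classical_set_scope.
Local Open Scope ring_scope.

(** * Normalisation of identities in a noncommutative ring *)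

Section NoncommutativeRingTactic.
Variable R : nzRingType.

#[local] Instance nzring_ops :
  @Ring_ops R 0 1 +%R *%R (fun x y => x - y) -%R eq := {}.

#[local] Instance nzring_ring : @Ring _ _ _ _ _ _ _ _ nzring_ops.
Proof.
split; try exact _.
- exact: add0r.
- exact: addrC.
- exact: addrA.
- exact: mul1r.
- exact: mulr1.
- exact: mulrA.
- exact: mulrDl.
- by move=> x y z; exact: mulrDr.
- by [].
- exact: subrr.
Qed.

End NoncommutativeRingTactic.

#[local] Existing Instance nzring_ops.
#[local] Existing Instance nzring_ring.

(** Squares are unfolded first because the declared operations comprise sums, products and opposites
    but no powers. *)
Ltac ncring := rewrite ?expr2; non_commutative_ring.

(** * The positive cone and the directed group *)

Section ERingTheory.
Variables (R : nzRingType) (E : set R).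
Hypothesis ER : e_ring E.
Implicit Types (c g h p q s x y z : R).
Local Notation P := (Eplus E).
Local Notation G := (dirgroup E).

Lemma Eplus_ind (A : set R) :
  A 0 -> (forall x y, A x -> A y -> A (x + y)) -> E `<=` A -> P `<=` A.
Proof.
move=> A0 AD EA _ [n [e [Ee ->]]].
by apply: (big_ind A) => // i _; exact: EA.
Qed.

Lemma Eplus0 : P 0.
Proof. by exists 0%N, (fun=> 0); split; [case|rewrite big_ord0]. Qed.

Lemma Eplus_effect e : E e -> P e.
Proof. by move=> Ee; exists 1%N, (fun=> e); split; rewrite ?big_ord1. Qed.

Lemma EplusD a b : P a -> P b -> P (a + b).
Proof.
move=> [m [e [Ee ->]]] [n [f [Ef ->]]]; exists (m + n)%N.
exists (fun i => match split i with inl j => e j | inr j => f j end); split.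
  by move=> i; case: (split i).
rewrite big_split_ord /=; congr (_ + _); apply: eq_bigr => i _.
  by rewrite (unsplitK (inl i)).
by rewrite (unsplitK (inr i)).
Qed.

Lemma Eplus1 : P 1. Proof. by apply: Eplus_effect; exact: ering_1. Qed.

Lemma EplusMn a n : P a -> P (a *+ n).
Proof.
move=> Pa; elim: n => [|n IH]; first by rewrite mulr0n; exact: Eplus0.
by rewrite mulrS; exact: EplusD.
Qed.

Lemma Eplus_eq a b : P a -> a = b -> P b. Proof. by move=> ? <-. Qed.

Lemma Eplus_trans y x z : P (y - x) -> P (z - y) -> P (z - x).
Proof. by move=> xy yz; apply: Eplus_eq (EplusD yz xy) _; rewrite subrKA. Qed.

Lemma Eplus_anti x : P x -> P (- x) -> x = 0.
Proof. exact: (ering_i ER). Qed.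

Lemma EplusM a b : P a -> P b -> GRing.comm a b -> P (a * b).
Proof. exact: (ering_iii ER). Qed.

Lemma effectP e : E e <-> P e /\ P (1 - e).
Proof.
split=> [Ee|[]]; last exact: (ering_ii ER).
by split; apply: Eplus_effect => //; exact: (ering_compl ER).
Qed.

Lemma Eplus_dirgroup a : P a -> G a.
Proof. by move=> Pa; exists a, 0; split; rewrite ?subr0 //; exact: Eplus0. Qed.

Lemma dirgroup0 : G 0. Proof. exact/Eplus_dirgroup/Eplus0. Qed.
Lemma dirgroup1 : G 1. Proof. exact/Eplus_dirgroup/Eplus1. Qed.

Lemma dirgroupN g : G g -> G (- g).
Proof. by move=> [a [b [Pa Pb ->]]]; exists b, a; rewrite opprB. Qed.

Lemma dirgroupD g h : G g -> G h -> G (g + h).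
Proof.
move=> [a [b [Pa Pb ->]]] [c [d [Pc Pd ->]]]; exists (a + c), (b + d).
by split; [exact: EplusD..|ncring].
Qed.

Lemma dirgroupB g h : G g -> G h -> G (g - h).
Proof. by move=> Gg /dirgroupN; exact: dirgroupD. Qed.

Lemma Eplus_sqr g : G g -> P (g ^+ 2).
Proof. by move=> [a [b [Pa Pb ->]]]; exact: (ering_vi ER). Qed.

Lemma Eplus_proj p : projections E p -> P p.
Proof. by move=> [Gp ->]; exact: Eplus_sqr. Qed.

Lemma proj_idem p : projections E p -> p * p = p.
Proof. by move=> [_]; rewrite expr2 => <-. Qed.

Lemma proj_compl p : projections E p -> projections E (1 - p).
Proof.
move=> Pp; split; first exact: (dirgroupB dirgroup1 Pp.1).
by rewrite expr2 mulrBl !mulrBr !mul1r !mulr1 (proj_idem Pp); ncring.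
Qed.

(** Each effect is at most 1, so a sum of [n] effects is at most [n], and subtracting a positive
    element preserves the bound. *)
Lemma dirgroup_bound g : G g -> exists n, P (n%:R - g).
Proof.
move=> [a [b [Pa Pb ->]]].
have: exists n, P (n%:R - a).
  move: a Pa; apply: Eplus_ind => [|x y [m Pm] [n Pn]|e Ee].
  - by exists 0%N; rewrite subrr; exact: Eplus0.
  - by exists (m + n)%N; apply: Eplus_eq (EplusD Pm Pn) _; rewrite natrD; ncring.
  - by exists 1%N; apply/Eplus_effect/(ering_compl ER).
by move=> [n Pn]; exists n; apply: Eplus_eq (EplusD Pn Pb) _; ncring.
Qed.

(** * Halving and dyadic scaling, which stand in for real scalars until [scal] enters *)

Section Half.
Variable hf : R.
Hypotheses (Ehf : E hf) (hfD : hf + hf = 1).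

Lemma halfD x : hf * x + hf * x = x.
Proof. by rewrite -mulrDl hfD mul1r. Qed.

Lemma half_uniq x y : y + y = x -> y = hf * x.
Proof. by move=> <-; rewrite mulrDr halfD. Qed.

(** [hf] is central because [x * hf] also doubles to [x], and only one element does. *)
Lemma half_comm x : GRing.comm x hf.
Proof. by apply: half_uniq; rewrite -mulrDr hfD mulr1. Qed.

Lemma half_inj x y : hf * x = hf * y -> x = y.
Proof. by move=> xy; rewrite -(halfD x) xy halfD. Qed.

Lemma half2 x : hf * (x *+ 2) = x.
Proof. by rewrite mulr2n mulrDr halfD. Qed.

Lemma Eplus_half a : P a -> P (hf * a).
Proof.
by move=> Pa; apply: EplusM => //; [exact: Eplus_effect|exact/commr_sym/half_comm].
Qed.

Lemma Eplus_halfX k a : P a -> P (hf ^+ k * a).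
Proof.
move=> Pa; elim: k => [|k IH]; first by rewrite mul1r.
by rewrite exprS -mulrA; exact: Eplus_half.
Qed.

Lemma dirgroup_half g : G g -> G (hf * g).
Proof.
move=> [a [b [Pa Pb ->]]]; exists (hf * a), (hf * b).
by rewrite mulrBr; split=> //; exact: Eplus_half.
Qed.

Lemma halfX_pow2 k x : hf ^+ k * (x *+ (2 ^ k)) = x.
Proof.
elim: k => [|k IH]; first by rewrite mul1r.
by rewrite exprSr expnS mulnC mulrnA -mulrA half2.
Qed.

Lemma halfX_comm k x : GRing.comm x (hf ^+ k).
Proof. exact/commrX/half_comm. Qed.

Lemma halfX_cancel k x : (hf ^+ k * x) *+ 2 ^ k = x.
Proof. by rewrite -mulrnAr halfX_pow2. Qed.

Lemma halfX_eq0 k x : hf ^+ k * x = 0 -> x = 0.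
Proof. by move=> x0; rewrite -(halfX_cancel k x) x0 mul0rn. Qed.

Lemma comm_halfX k c x : GRing.comm c (hf ^+ k * x) -> GRing.comm c x.
Proof. by move=> cx; rewrite -(halfX_cancel k x); exact: commrMn. Qed.

Lemma comm_halfXr k c x : GRing.comm c x -> GRing.comm c (hf ^+ k * x).
Proof. by move=> cx; apply/commrM => //; exact: halfX_comm. Qed.

Lemma halfX_le1 k : P (1 - hf ^+ k).
Proof.
elim: k => [|k IH]; first by rewrite subrr; exact: Eplus0.
apply: Eplus_eq (Eplus_half (EplusD IH Eplus1)) _.
by rewrite addrAC mulrBr -exprS mulrDr mulr1 hfD.
Qed.

Lemma dirgroup_halfX k g : G g -> G (hf ^+ k * g).
Proof.
move=> Gg; elim: k => [|k IH]; first by rewrite mul1r.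
by rewrite exprS -mulrA; exact: dirgroup_half.
Qed.

(** Polarisation expresses the product of commuting elements by squares, which lie in the cone. *)
Lemma dirgroupM g h : G g -> G h -> GRing.comm g h -> G (g * h).
Proof.
move=> Gg Gh gh; have -> : g * h = hf * ((g + h) ^+ 2 - g ^+ 2 - h ^+ 2).
  apply: half_uniq; rewrite !expr2 mulrDl !mulrDr -gh; ncring.
have GsqrE x : G x -> G (x ^+ 2) by move=> ?; exact/Eplus_dirgroup/Eplus_sqr.
by apply/dirgroup_half/dirgroupB; [apply/dirgroupB|];
  apply/GsqrE => //; exact: dirgroupD.
Qed.

(** Since [n <= 2 ^ n], an integer bound on [g] is also a bound by [2 ^ n], which scales to 1. *)
Lemma order_unit_half g : G g -> exists k, P (1 - hf ^+ k * g).
Proof.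
move=> /dirgroup_bound [n Pn]; exists n.
have := Eplus_halfX n (EplusD (EplusMn (2 ^ n - n) Eplus1) Pn).
rewrite addrA -natrD subnK; last exact/ltnW/ltn_expl.
by rewrite mulrBr halfX_pow2.
Qed.

(** * Suprema of commuting sequences and the archimedean property *)

Section AHTheory.
Hypotheses (QA : quadratic_annihilation E) (CV : commutative_vigier E).

Lemma dirgroup_nil d : G d -> d ^+ 2 = 0 -> d = 0.
Proof.
move=> Gd dd; have [] := QA Gd dirgroup1; last by rewrite mulr1.
by rewrite expr1n mulr1 -expr2.
Qed.

Lemma QA_comm g h : G g -> G h -> g * h = 0 -> h * g = 0.
Proof.
by move=> Gg Gh gh0; case: (QA Gg Gh) => //; rewrite expr2 mulrA gh0 !mul0r.
Qed.

(** The commutative Vigier property in terms of differences in [P] and elementwise commutation, the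
    form in which every supremum below is taken. *)
Lemma vigier_sup (u : nat -> R) : (forall n, G (u n)) ->
    (forall n, P (u n.+1 - u n)) -> (forall m n, GRing.comm (u m) (u n)) ->
    (exists2 b, G b & forall n, P (b - u n)) ->
  exists s, [/\ G s, forall n, P (s - u n),
    forall y, G y -> (forall n, P (y - u n)) -> P (y - s) &
    forall c, G c -> (forall n, GRing.comm c (u n)) -> GRing.comm s c].
Proof.
move=> Gu u_incr u_comm u_bd.
have [s [[Gs us s_min] [_ sC]]] := CV Gu u_incr u_comm u_bd.
exists s; split=> // [n|y Gy uy|c Gc cu].
- by apply: us; exists n.
- by apply: s_min => // _ [n _ <-]; exact: uy.
- by apply: sC; split=> // _ [n _ <-]; exact: cu.
Qed.

(** Here [s - x] is an upper bound of [u], so [s <= s - x]. Together with a separate proof of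
    [0 <= x] this gives [x = 0], replacing a passage to the limit. *)
Lemma vigier_gap (u : nat -> R) s x :
    (forall y, G y -> (forall n, P (y - u n)) -> P (y - s)) ->
  G s -> G x -> (forall n, P (s - u n - x)) -> P (- x).
Proof.
move=> s_min Gs Gx ux; apply: (@Eplus_eq (s - x - s)); last by ncring.
by apply: s_min => [|n]; [exact: dirgroupB|rewrite addrAC].
Qed.

(** Let [s] be the supremum of the sequence [- hf ^+ k]. Doubling shifts the sequence by one index,
    so [s + s] is also an upper bound and [s >= 0]; as [- g] is another upper bound,
    [- g >= s >= 0]. *)
Lemma archimedean_half g : G g -> (forall k, P (hf ^+ k - g)) -> P (- g).
Proof.
move=> Gg gP; pose u k := - hf ^+ k.
have Ghf k : G (hf ^+ k).
  by rewrite -(mulr1 (_ ^+ _)); exact/dirgroup_halfX/dirgroup1.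
have uP k : P (hf ^+ k) by rewrite -(mulr1 (_ ^+ _)); exact/Eplus_halfX/Eplus1.
have [||||s [Gs us s_min _]] := @vigier_sup u.
- by move=> n; exact: dirgroupN.
- move=> n; apply: (Eplus_eq (uP n.+1)).
  rewrite /u -[in RHS](halfD (hf ^+ n)) -exprS; ncring.
- move=> m n; apply/commrN/commr_sym/commrN/halfX_comm.
- by exists 0; [exact: dirgroup0|move=> n; rewrite opprK add0r].
have s_ge0 : P s.
  apply: (@Eplus_eq (s + s - s)); last by rewrite addrK.
  apply: s_min => [|n]; first exact: dirgroupD.
  apply: Eplus_eq (EplusD (us n.+1) (us n.+1)) _.
  by rewrite /u -[in RHS](halfD (hf ^+ n)) -exprS; ncring.
apply: (@Eplus_eq (- g - s + s)); last by rewrite subrK.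
apply: EplusD => //; apply: s_min => [|n]; first exact: dirgroupN.
by apply: Eplus_eq (gP n) _; rewrite /u; ncring.
Qed.

Lemma archimedean_dirgroup : archimedean G (ele E).
Proof.
move=> g h Gg Gh gh; rewrite /ele sub0r.
apply: archimedean_half => // k; have [j hP] := order_unit_half Gh.
(* As [hf ^+ j * h <= 1], the multiple [2 ^ (j + k)] yields [g <= hf ^+ (j + k) * h <= hf ^+ k]. *)
have n_gt0 : (0 < 2 ^ (j + k))%N by rewrite expn_gt0.
have ghP := gh _ n_gt0.
have := Eplus_halfX k (EplusD (Eplus_halfX j ghP) hP).
rewrite mulrBr addrC addrA subrK mulrBr mulr1 mulrA -exprD addnC.
by rewrite halfX_pow2.
Qed.

(** * Square roots *)

(** The supremum [s] of the iterates is shown to be a fixed point, [b + s ^+ 2 = s + s], by two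
    inequalities instead of continuity; this equation says that [1 - s] squares to [g]. *)
Lemma sqrt_exists_unit g : P g -> P (1 - g) ->
  exists s, [/\ P s, s ^+ 2 = g & forall c, G c -> GRing.comm c g -> GRing.comm c s].
Proof.
move=> g_ge0 g_le1; pose b := 1 - g.
have Gb : G b by exact: Eplus_dirgroup.
pose y n := iter n (fun x => hf * (b + x ^+ 2)) 0.
have yS n : y n.+1 = hf * (b + y n ^+ 2) by [].
have yC c n : GRing.comm c b -> GRing.comm c (y n).
  move=> cb; elim: n => [|n IH]; first exact: commr0.
  by rewrite yS; apply/commrM; [exact: half_comm|apply: commrD => //; exact: commrX].
have yy m n : GRing.comm (y m) (y n) by apply/yC/commr_sym/yC.
have y_ge0 n : P (y n).
  elim: n => [|n IH]; first exact: Eplus0.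
  by apply/Eplus_half/EplusD => //; exact/Eplus_sqr/Eplus_dirgroup.
have Gy n : G (y n) by exact: Eplus_dirgroup.
have y_le1 n : P (1 - y n).
  elim: n => [|n IH]; first by rewrite subr0; exact: Eplus1.
  have -> : 1 - y n.+1 = hf * (g + (1 - y n) * (1 + y n)).
    rewrite yS -{1}(halfD 1) /b; ncring.
  apply/Eplus_half/EplusD => //; apply: EplusM => //.
    by apply: EplusD => //; exact: Eplus1.
  by apply/commrD; [exact: commr1|apply/commr_sym/commrB; [exact: commr1|]].
have y_incr n : P (y n.+1 - y n).
  elim: n => [|n IH]; first by rewrite subr0.
  have -> : y n.+2 - y n.+1 = hf * ((y n.+1 - y n) * (y n.+1 + y n)).
    rewrite (yS n.+1) {2}(yS n); move: (yy n n.+1); rewrite /GRing.comm => yny.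
    by rewrite mulrBl !mulrDr yny; ncring.
  apply/Eplus_half/EplusM => //; first exact: EplusD.
  by apply/commr_sym/commrB; apply/commr_sym/commrD.
have [||||s [Gs ys s_min sC]] := @vigier_sup y => //.
  by exists 1; [exact: dirgroup1|].
have s_ge0 : P s by apply: Eplus_eq (ys 0%N) _; rewrite subr0.
have s_le1 : P (1 - s) by apply: s_min => //; exact: dirgroup1.
have sy n : GRing.comm s (y n) by apply: sC.
have sqle n : P ((s - y n) * (s + y n)).
  apply: EplusM => //; first by apply: EplusD.
  by apply/commrD; apply/commr_sym/commrB => //; apply/commr_sym.
have sq_sub n : (s - y n) * (s + y n) = s ^+ 2 - y n ^+ 2.
  by rewrite mulrBl !mulrDr (sy n); ncring.
have Gs2 : G (s ^+ 2) by exact/Eplus_dirgroup/Eplus_sqr.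
(* Squaring is monotone on these commuting positive elements, so [hf * (b + s ^+ 2)] dominates every
   [y n.+1]; the index 0 is treated apart. *)
have s_le : P (hf * (b + s ^+ 2) - s).
  apply: s_min => [|[|n]]; first exact/dirgroup_half/dirgroupD.
    by rewrite subr0; apply/Eplus_half/EplusD => //; exact: Eplus_sqr.
  apply: Eplus_eq (Eplus_half (sqle n)) _; rewrite sq_sub yS; ncring.
have le_s : P (s - hf * (b + s ^+ 2)).
  rewrite -opprB; apply: (@vigier_gap y s) => // [|n].
    by apply: dirgroupB => //; exact/dirgroup_half/dirgroupD.
  (* The element [hf * (b + s ^+ 2)] exceeds [y n.+1] by at most [s - y n]. The last product is the
     slack, positive because [s] and [y n] are at most 1. *)
  have -> : s - y n - (hf * (b + s ^+ 2) - s) =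
      s - y n.+1 + (s - y n) * (hf * ((1 - s) + (1 - y n))).
    rewrite [in RHS]mulrA (half_comm (s - y n)) -mulrA.
    rewrite -{1}(halfD (s - y n)) yS.
    have -> : (s - y n) * (1 - s + (1 - y n)) =
      (s - y n) + (s - y n) - (s - y n) * (s + y n) by ncring.
    by rewrite sq_sub; ncring.
  apply: EplusD => //; apply: EplusM => //; first exact/Eplus_half/EplusD.
  apply/commrM; first exact: half_comm.
  by apply/commrD; (apply/commrB; first exact: commr1);
    apply/commr_sym/commrB => //; apply/commr_sym.
have s_eq : b + s ^+ 2 = s + s.
  apply: half_inj; rewrite [RHS]mulrDr halfD; apply/eqP; rewrite -subr_eq0; apply/eqP.
  by apply: Eplus_anti s_le _; rewrite opprB.
exists (1 - s); split=> // [|c Gc cg].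
  have -> : (1 - s) ^+ 2 = 1 - (s + s) + s ^+ 2 by ncring.
  by rewrite -s_eq /b; ncring.
apply/commrB; first exact: commr1.
by apply/commr_sym/sC => // n; apply/yC/commrB => //; exact: commr1.
Qed.

Lemma sqrt_exists g : P g ->
  exists s, [/\ P s, s ^+ 2 = g & forall c, G c -> GRing.comm c g -> GRing.comm c s].
Proof.
move=> g_ge0; have [k gk] := order_unit_half (Eplus_dirgroup g_ge0).
(* The scaling exponent is even, so multiplying the root by [2 ^ k] undoes it. *)
have [||s [s_ge0 s2 sC]] := @sqrt_exists_unit (hf ^+ (k * 2) * g).
- exact: Eplus_halfX.
- apply: Eplus_eq (EplusD (Eplus_halfX k gk) (halfX_le1 k)) _.
  by rewrite mulrBr mulr1 mulrA -exprD muln2 addnn addrC subrKA.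
exists (s *+ 2 ^ k); split=> [||c Gc cg]; first exact: EplusMn.
  by rewrite exprMn_n s2 -expnM halfX_cancel.
by apply/commrMn/sC => //; exact: comm_halfXr.
Qed.

(** With [d = s - t], the positive elements [d ^+ 2 * s] and [d ^+ 2 * t] add up to
    [d * (s ^+ 2 - t ^+ 2) = 0]. Hence both vanish, [d ^+ 4 = 0], and [dirgroup_nil] applies
    twice. *)
Lemma sqrt_unique s t : P s -> P t -> GRing.comm s t -> s ^+ 2 = t ^+ 2 -> s = t.
Proof.
move=> s_ge0 t_ge0 st s2t2; set d := s - t.
have Gd : G d by apply: dirgroupB; exact: Eplus_dirgroup.
have ds : GRing.comm d s by apply/commr_sym/commrB.
have dt : GRing.comm d t by apply/commr_sym/commrB => //; exact: commr_sym.
have d_sum : d ^+ 2 * s + d ^+ 2 * t = 0.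
  rewrite -mulrDr expr2 -mulrA [X in d * X](_ : _ = 0) ?mulr0 //.
  by rewrite mulrBl !mulrDr st -!expr2 s2t2; ncring.
have dds : P (d ^+ 2 * s).
  by apply: EplusM (Eplus_sqr Gd) s_ge0 _; apply/commr_sym/commrX.
have ddt : P (d ^+ 2 * t).
  by apply: EplusM (Eplus_sqr Gd) t_ge0 _; apply/commr_sym/commrX.
have dds0 : d ^+ 2 * s = 0.
  by apply: Eplus_anti dds _; rewrite (addr0_eq d_sum).
have ddt0 : d ^+ 2 * t = 0 by rewrite dds0 add0r in d_sum.
apply: subr0_eq; apply: dirgroup_nil => //.
apply: dirgroup_nil; first exact/Eplus_dirgroup/Eplus_sqr.
have -> : (d ^+ 2) ^+ 2 = (d ^+ 2 * s - d ^+ 2 * t) * d.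
  by rewrite -mulrBr -/d -mulrA -expr2 -[RHS]expr2.
by rewrite dds0 ddt0 subrr mul0r.
Qed.

(** * Carrier projections and positive parts *)

(** The supremum [p] of the [1 - b ^+ n] annihilates whatever [g] annihilates, and the archimedean
    property gives [g * (1 - p) = 0]. Applying the first fact to [1 - p] makes [p] idempotent. *)
Lemma carrier_exists_unit g : P g -> P (1 - g) -> exists p,
  [/\ projections E p, forall h, G h -> (g * h = 0 <-> p * h = 0) &
      forall c, G c -> GRing.comm c g -> GRing.comm c p].
Proof.
move=> g_ge0 b_ge0; set b := 1 - g in b_ge0.
have gb : GRing.comm g b by apply/commrB; first exact: commr1.
have bX_ge0 n : P (b ^+ n).
  elim: n => [|n IH]; first exact: Eplus1.
  by rewrite exprS; apply: EplusM => //; exact: commrX.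
pose u n := 1 - b ^+ n.
have uC c n : GRing.comm c g -> GRing.comm c (u n).
  by move=> cg; apply/commrB; [exact: commr1|apply/commrX/commrB; [exact: commr1|]].
have gu n : GRing.comm g (u n) by exact: uC.
have uu m n : GRing.comm (u m) (u n) by apply/uC/commr_sym.
have Gu n : G (u n) by apply: dirgroupB; [exact: dirgroup1|exact: Eplus_dirgroup].
have uS n : u n.+1 = u n + g * b ^+ n.
  by rewrite /u exprS {1}/b mulrBl; ncring.
have gbX_ge0 n : P (g * b ^+ n) by apply: EplusM => //; exact: commrX.
have u_incr n : P (u n.+1 - u n) by rewrite uS addrC addKr.
have u_le1 n : P (1 - u n) by rewrite opprB addrC subrK.
have [|p [Gp up p_min pC]] := @vigier_sup u Gu u_incr uu.
  by exists 1; [exact: dirgroup1|].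
have p_ge0 : P p by apply: Eplus_eq (up 0%N) _; rewrite /u subrr subr0.
have p_le1 : P (1 - p) by apply: p_min => //; exact: dirgroup1.
have pCg c : G c -> GRing.comm c g -> GRing.comm p c.
  by move=> Gc cg; apply: pC => // n; exact: uC.
have pg : GRing.comm p g by apply: pCg => //; exact: Eplus_dirgroup.
have pu n : GRing.comm p (u n) by apply: pCg => //; exact/commr_sym.
have g0p0 h : G h -> g * h = 0 -> p * h = 0.
  move=> Gh gh0; have hg0 := QA_comm (Eplus_dirgroup g_ge0) Gh gh0.
  have hg : GRing.comm h g by rewrite /GRing.comm gh0.
  have ph := pCg h Gh hg.
  have uh n : u n * h = 0.
    suff bh : b ^+ n * h = h by rewrite mulrBl mul1r bh subrr.
    elim: n => [|n IH]; first by rewrite mul1r.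
    by rewrite exprSr -mulrA mulrBl mul1r gh0 subr0.
  (* The argument requires an element between 0 and 1, so [h] is replaced by a scaled square; QA
     recovers [p * h = 0] at the end. *)
  have Gh2 := Eplus_dirgroup (Eplus_sqr Gh).
  have [k hk] := order_unit_half Gh2.
  set x := hf ^+ k * h ^+ 2 in hk.
  have px : GRing.comm p x by apply/comm_halfXr/commrX.
  have ux n : u n * x = 0.
    by rewrite /x mulrA halfX_comm -mulrA expr2 (mulrA (u n)) uh mul0r mulr0.
  have xu n : GRing.comm x (u n).
    by apply/commr_sym/comm_halfXr/commrX/commr_sym/uC.
  have x_ge0 : P x by exact/Eplus_halfX/Eplus_sqr.
  have px0 : p * x = 0.
    apply: Eplus_anti; first exact: EplusM.
    apply: (vigier_gap p_min) => // [|n].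
      by apply: dirgroupM => //; exact: Eplus_dirgroup.
    (* The factorisation shows that [p - p * x] is still an upper bound of [u]. *)
    have -> : p - u n - p * x = (p - u n) * (1 - x).
      by rewrite mulrBr mulr1 mulrBl ux; ncring.
    apply: EplusM => //; apply/commrB; first exact: commr1.
    by apply/commr_sym/commrB => //; apply/commr_sym.
  have ph2 : p * h ^+ 2 = 0.
    by apply: (@halfX_eq0 k); rewrite mulrA -halfX_comm -mulrA.
  by case: (QA Gp Gh) => //; rewrite ph2 mul0r.
have gp1 : g * (1 - p) = 0.
  have gp1_ge0 : P (g * (1 - p)).
    by apply: EplusM => //; apply/commrB; [exact: commr1|exact/commr_sym].
  apply: Eplus_anti => //; rewrite -sub0r.
  apply: (@archimedean_dirgroup _ 1); [exact: Eplus_dirgroup|exact: dirgroup1|].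
  move=> n _; rewrite /ele.
  (* The increments [g * b ^+ i] of [u] decrease, so [u n] is at least [n] times [g * b ^+ n]. As
     [1 - p <= b ^+ n], every multiple of [g * (1 - p)] is then at most 1. *)
  have un : P (u n - (g * b ^+ n) *+ n).
    elim: n => [|n IH]; first by rewrite /u subrr mulr0n subrr; exact: Eplus0.
    have gbg : P (g * b ^+ n * g).
      apply: EplusM => //; apply/commr_sym/commrM => //; exact: commrX.
    apply: Eplus_eq (EplusD IH (EplusMn n.+1 gbg)) _.
    rewrite uS exprSr; set w := g * b ^+ n.
    have -> : g * (b ^+ n * b) = w - w * g by rewrite mulrA mulrBr mulr1.
    by rewrite mulrnBl !mulrS; ncring.
  have gpu : P (g * (p - u n) *+ n).
    by apply/EplusMn/EplusM => //; apply/commrB => //; exact/commr_sym.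
  apply: Eplus_eq (EplusD (EplusD un (u_le1 n)) gpu) _.
  have -> : g * (p - u n) = g * b ^+ n - g * (1 - p).
    by rewrite -mulrBr /u; congr (_ * _); ncring.
  by rewrite mulrnBl; ncring.
have gpE : g * p = g by apply/esym/subr0_eq; move: gp1; rewrite mulrBr mulr1.
have pp : p * (1 - p) = 0.
  by apply: g0p0 => //; exact: Eplus_dirgroup.
exists p; split=> [|h Gh|c Gc cg]; last exact/commr_sym/pCg.
  by split=> //; apply: subr0_eq; rewrite -pp mulrBr mulr1 expr2.
by split=> [|ph0]; [exact: g0p0|rewrite -gpE -mulrA ph0 mulr0].
Qed.

(** A scaled square of [g] lies between 0 and 1 and, by QA, has the same annihilator in [G] as
    [g]. *)
Lemma carrier_exists g : G g -> exists p,
  [/\ projections E p, forall h, G h -> (g * h = 0 <-> p * h = 0) &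
      forall c, G c -> GRing.comm c g -> GRing.comm c p].
Proof.
move=> Gg; have g2_ge0 := Eplus_sqr Gg.
have [k gk] := order_unit_half (Eplus_dirgroup g2_ge0).
have [p [Pp pE pC]] := carrier_exists_unit (Eplus_halfX k g2_ge0) gk.
exists p; split=> // [h Gh|c Gc cg]; last first.
  by apply: pC => //; exact/comm_halfXr/commrX.
rewrite -pE //; split=> [gh0|]; first by rewrite -mulrA expr2 -mulrA gh0 !mulr0.
rewrite -mulrA => /halfX_eq0 g2h0.
by case: (QA Gh Gg) => //; rewrite -mulrA g2h0 mulr0.
Qed.

(* Both parts are multiples of |g| >= 0 by a projection commuting with it, which
   is why they are positive. *)
Lemma pos_part_proj g m : G g -> P m -> m ^+ 2 = g ^+ 2 -> GRing.comm g m ->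
  exists p, [/\ projections E p, P (hf * (m + g)), P (hf * (m - g)),
    p * g = hf * (m + g) &
    forall c, G c -> GRing.comm c g -> GRing.comm c m -> GRing.comm c p].
Proof.
move=> Gg m_ge0 m2 gm; have Gm := Eplus_dirgroup m_ge0.
set f := hf * (m + g); set n := hf * (m - g).
have Gf : G f by exact/dirgroup_half/dirgroupD.
have Gn : G n by exact/dirgroup_half/dirgroupB.
have [p [Pp pE pC]] := carrier_exists Gf.
(* The two parts are orthogonal because [m] and [g] commute and have equal squares; hence the
   carrier of [f] kills [n]. *)
have fn0 : f * n = 0.
  rewrite /f /n mulrA -(mulrA hf) (half_comm (m + g)) !mulrA -mulrA.
  suff -> : (m + g) * (m - g) = 0 by rewrite mulr0.
  by rewrite mulrDl !mulrBr gm -!expr2 m2; ncring.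
have pn0 : p * n = 0 by apply/pE.
have pC' c : G c -> GRing.comm c g -> GRing.comm c m -> GRing.comm c p.
  move=> Gc cg cm; apply: pC => //; apply/commrM; first exact: half_comm.
  exact/commrD.
have pf : p * f = f.
  have fp : GRing.comm f p by apply: pC.
  apply/esym/subr0_eq; rewrite -fp -{1}(mulr1 f) -mulrBr.
  apply/(pE _ (proj_compl Pp).1).
  by rewrite mulrBr mulr1 (proj_idem Pp) subrr.
have fDn : f + n = m by rewrite /f /n -mulrDr addrACA subrr addr0 mulrDr halfD.
have fBn : f - n = g.
  by rewrite /f /n -[RHS]halfD -mulrBr -mulrDr; congr (_ * _); ncring.
have pm : p * m = f by rewrite -fDn mulrDr pf pn0 addr0.
have mp : GRing.comm m p by apply: pC' => //; exact/commr_sym.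
exists p; split=> //.
- by rewrite -/f -pm; apply: EplusM => //; exact: Eplus_proj.
- have -> : n = (1 - p) * m by rewrite mulrBl mul1r pm -fDn addrC addKr.
  apply: EplusM => //; first exact/Eplus_proj/proj_compl.
  by apply/commr_sym/commrB; [exact: commr1|].
- by rewrite -fBn mulrBr pf pn0 subr0.
Qed.

(** * Binary expansion into projections *)

Lemma split_proj g : G g -> exists p,
  [/\ projections E p, P (p * g), P (- ((1 - p) * g)) &
      forall c, G c -> GRing.comm c g -> GRing.comm c p].
Proof.
move=> Gg; have [m [m_ge0 m2 mC]] := sqrt_exists (Eplus_sqr Gg).
have mCg c : G c -> GRing.comm c g -> GRing.comm c m.
  by move=> Gc cg; apply: mC => //; exact: commrX.
have [p [Pp pos neg pg pC]] := pos_part_proj Gg m_ge0 m2 (mCg g Gg (erefl _)).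
exists p; split=> // [||c Gc cg]; first by rewrite pg.
  rewrite mulrBl mul1r pg -{1}(halfD g) -mulrDr -mulrBr -mulrN.
  by apply: Eplus_eq neg _; congr (_ * _); ncring.
by apply: pC => //; exact: mCg.
Qed.

(* p is the digit of g in base 2 and g + g - p the remaining fraction. *)
Lemma binary_digit g : P g -> P (1 - g) -> exists p,
  [/\ projections E p, P (g + g - p), P (1 - (g + g - p)) &
      forall c, G c -> GRing.comm c g -> GRing.comm c p].
Proof.
move=> g_ge0 g_le1; have Gg := Eplus_dirgroup g_ge0.
have Ghf := Eplus_dirgroup (Eplus_effect Ehf).
have [p [Pp pos neg pC]] := split_proj (dirgroupB Gg Ghf).
have pCg c : G c -> GRing.comm c g -> GRing.comm c p.
  by move=> Gc cg; apply: pC => //; apply/commrB => //; exact: half_comm.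
have gp := pCg g Gg (erefl _).
have hE x : x * hf + x * hf = x by rewrite -mulrDr hfD mulr1.
exists p; split=> //.
(* The remaining fraction is [g + g - 1] on [p] and [g + g] on [1 - p]. *)
- have qg : P ((1 - p) * g).
    apply: EplusM => //; first exact/Eplus_proj/proj_compl.
    by apply/commr_sym/commrB; [exact: commr1|].
  apply: Eplus_eq (EplusD (EplusD pos pos) (EplusD qg qg)) _.
  by transitivity (g + g - (p * hf + p * hf)); [ncring|rewrite hE].
- have pg : P (p * (1 - g)).
    apply: EplusM => //; first exact/Eplus_proj.
    by apply/commrB; [exact: commr1|exact/commr_sym].
  apply: Eplus_eq (EplusD (EplusD pg pg) (EplusD neg neg)) _.
  transitivity (p + p - (g + g) + (hf + hf) - (p * hf + p * hf)); first ncring.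
  by rewrite hE hfD; ncring.
Qed.

Lemma comm_of_projections_unit g h : P g -> P (1 - g) -> G h ->
    (forall p, projections E p ->
       (forall c, G c -> GRing.comm c g -> GRing.comm c p) -> GRing.comm h p) ->
  GRing.comm h g.
Proof.
move=> g_ge0 g_le1 Gh hp; have Gg := Eplus_dirgroup g_ge0.
(* Digits are chosen by a total function, with the default value 0 outside the unit interval. *)
have /choice [d dP] x : exists p, P x -> P (1 - x) ->
    [/\ projections E p, P (x + x - p), P (1 - (x + x - p)) &
        forall c, G c -> GRing.comm c x -> GRing.comm c p].
  have [[x0 x1]|nx] := pselect (P x /\ P (1 - x)); last first.
    by exists 0 => x0 x1; case: nx.
  by have [p pP] := binary_digit x0 x1; exists p.
pose r n := iter n (fun x => x + x - d x) g.
have rP n : [/\ P (r n), P (1 - r n) &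
    forall c, G c -> GRing.comm c g -> GRing.comm c (r n)].
  elim: n => [//|n [r0 r1 rC]]; have [_ r0' r1' dC] := dP _ r0 r1.
  split=> // c Gc cg; have cr := rC c Gc cg.
  by apply/commrB; [exact/commrD|exact: dC].
have drP n : projections E (d (r n)) /\
    forall c, G c -> GRing.comm c g -> GRing.comm c (d (r n)).
  have [r0 r1 rC] := rP n; have [? _ _ dC] := dP _ r0 r1.
  by split=> // c Gc cg; apply: dC => //; exact: rC.
(* Since [r n] is the remainder after [n] digits, [v n] is the [n]-th partial sum of the
   expansion. *)
pose v n := g - hf ^+ n * r n.
have vS n : v n.+1 = v n + hf ^+ n.+1 * d (r n).
  rewrite /v -(halfD (hf ^+ n * r n)) !mulrA -exprS /=.
  ncring.
have vC c : (forall n, GRing.comm c (d (r n))) -> forall n, GRing.comm c (v n).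
  move=> cd; elim=> [|n IH]; first by rewrite /v mul1r subrr; exact: commr0.
  by rewrite vS; apply/commrD => //; exact: comm_halfXr.
have dd m n : GRing.comm (d (r m)) (d (r n)).
  have [[Gm _] mC] := drP m; have [_ nC] := drP n.
  by apply: nC => //; exact/commr_sym/mC.
have vv m n : GRing.comm (v m) (v n).
  by apply: (vC (v m)) => k; apply/commr_sym; exact: vC.
have Gv n : G (v n).
  by apply: dirgroupB => //; apply/dirgroup_halfX/Eplus_dirgroup; case: (rP n).
have gv n : P (g - v n).
  by rewrite opprB addrC subrK; apply: Eplus_halfX; case: (rP n).
have [||s [Gs vs s_min sC]] := @vigier_sup v Gv _ vv.
- by move=> n; rewrite vS addrC addKr; apply/Eplus_halfX/Eplus_proj; case: (drP n).
- by exists g.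
(* The remainders are at most 1, so [g - s <= hf ^+ k] for all [k], and the expansion converges to
   [g] itself. *)
have -> : g = s.
  apply: subr0_eq; apply: Eplus_anti; first exact: s_min.
  apply: archimedean_half; first exact: dirgroupB.
  move=> k; have [_ r1 _] := rP k.
  apply: Eplus_eq (EplusD (Eplus_halfX k r1) (vs k)) _.
  by rewrite mulrBr mulr1 /v; ncring.
apply/commr_sym/sC => // n; apply: vC => {}n.
by have [dn dC] := drP n; exact: hp.
Qed.

(** A dyadic affine map brings [g] into the unit interval without changing which elements commute
    with it. *)
Lemma comm_of_projections g h : G g -> G h ->
    (forall p, projections E p ->
       (forall c, G c -> GRing.comm c g -> GRing.comm c p) -> GRing.comm h p) ->
  GRing.comm h g.
Proof.
move=> Gg Gh hp.
have [j gj] := order_unit_half (dirgroupN Gg).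
have [k gk] := order_unit_half (Eplus_dirgroup gj).
set x := hf ^+ k * _ in gk.
have xC c : GRing.comm c g -> GRing.comm c x.
  move=> cg; apply/comm_halfXr/commrB; first exact: commr1.
  exact/comm_halfXr/commrN.
have hx : GRing.comm h x.
  apply: comm_of_projections_unit => // [|p Pp pC]; first exact: Eplus_halfX.
  by apply: hp => // c Gc cg; apply: pC => //; exact: xC.
have := commrB (commr1 h) (comm_halfX hx); rewrite opprB addrC subrK.
by move=> /comm_halfX /commrN; rewrite opprK.
Qed.

(** * Values of [esqrt], [eabs] and [carrier] in [G] *)

(** A competing root [t] commutes with its own square [g], hence with [s], so [sqrt_unique]
    applies. *)
Lemma esqrt_eq g s : P s -> s ^+ 2 = g ->
  (forall c, G c -> GRing.comm c g -> GRing.comm c s) -> esqrt E g = s.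
Proof.
move=> s_ge0 s2 sC; apply: xget_unique => [|t [Gt]].
  by split; rewrite /ele ?subr0 //; exact: Eplus_dirgroup.
rewrite /ele subr0 => t_ge0 t2; apply: sqrt_unique => //; last by rewrite t2.
by apply: sC => //; rewrite -t2; exact: commrX.
Qed.

Lemma eabsP g : G g -> [/\ P (eabs E g), eabs E g ^+ 2 = g ^+ 2 &
  forall c, G c -> GRing.comm c g -> GRing.comm c (eabs E g)].
Proof.
move=> Gg; have [s [s_ge0 s2 sC]] := sqrt_exists (Eplus_sqr Gg).
rewrite /eabs (esqrt_eq s_ge0 s2 sC); split=> // c Gc cg.
by apply: sC => //; exact: commrX.
Qed.

(** Two projections with the same annihilator each kill the complement of the other; [QA_comm]
    reverses one of these products and identifies them. *)
Lemma carrierP g : G g -> [/\ projections E (carrier E g),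
  forall h, G h -> (g * h = 0 <-> carrier E g * h = 0) &
  forall c, G c -> GRing.comm c g -> GRing.comm c (carrier E g)].
Proof.
move=> Gg; have [p [Pp pE pC]] := carrier_exists Gg.
suff -> : carrier E g = p by split.
apply: xget_unique => // q [Pq qE].
have [p'G q'G] := ((proj_compl Pp).1, (proj_compl Pq).1).
have qp : q * p = q.
  apply/esym/subr0_eq; rewrite -{1}(mulr1 q) -mulrBr; apply/qE/pE => //.
  by rewrite mulrBr mulr1 proj_idem ?subrr.
have pq : p * (1 - q) = 0.
  by apply/pE/qE => //; rewrite mulrBr mulr1 proj_idem ?subrr.
have := QA_comm Pp.1 q'G pq.
by rewrite mulrBl mul1r qp => /subr0_eq.
Qed.

(** * Commutativity and closure properties of a C-block *)

Section CBlock.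
Variable B : set R.
Hypothesis blockB : is_block E B.
Local Notation H := (commutant E B).

Lemma CblockG g : H g -> G g. Proof. by case. Qed.
Lemma CblockC g b : H g -> B b -> GRing.comm g b. Proof. by move=> [_]; exact. Qed.

Lemma block_sub_Cblock : B `<=` H.
Proof.
case: blockB => -[BP BC] _ b Bb; split; first by case: (BP b Bb).
by move=> c; exact: BC.
Qed.

Lemma block_max p : projections E p -> H p -> B p.
Proof.
case: blockB => -[BP BC] Bmax Pp [_ pB].
have <- : B `|` [set p] = B; last by right.
apply: Bmax => [|b Bb]; last by left.
split=> [q [Bq|->]|q r [Bq|->] [Br|->]] //.
- exact: BP.
- exact: BC.
- exact/commr_sym/pB.
- exact: pB.
Qed.

(** The membership test for square roots and carriers: each [b] in [B] commutes with [h], hence with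
    anything in the bicommutant of [h]. *)
Lemma Cblock_closed h x : H h -> G x ->
  (forall c, G c -> GRing.comm c h -> GRing.comm c x) -> H x.
Proof.
move=> [Gh hB] Gx hx; split=> // b Bb; apply/commr_sym/hx.
  exact/CblockG/block_sub_Cblock.
exact/commr_sym/hB.
Qed.

Lemma Cblock_comm g h : H g -> H h -> GRing.comm g h.
Proof.
move=> Hg Hh; apply: comm_of_projections => [||p Pp pC]; [exact: CblockG..|].
apply: CblockC => //; apply: block_max => //.
by apply: Cblock_closed pC => //; case: Pp.
Qed.

Lemma Cblock0 : H 0.
Proof. by split=> [|b _]; [exact: dirgroup0|exact/commr_sym/commr0]. Qed.

Lemma Cblock1 : H 1.
Proof. by split=> [|b _]; [exact: dirgroup1|exact/commr_sym/commr1]. Qed.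

Lemma CblockN g : H g -> H (- g).
Proof.
move=> [Gg gB]; split=> [|b Bb]; first exact: dirgroupN.
exact/commr_sym/commrN/commr_sym/gB.
Qed.

Lemma CblockD g h : H g -> H h -> H (g + h).
Proof.
move=> [Gg gB] [Gh hB]; split=> [|b Bb]; first exact: dirgroupD.
by apply/commr_sym/commrD; apply/commr_sym; [exact: gB|exact: hB].
Qed.

Lemma CblockB g h : H g -> H h -> H (g - h).
Proof. by move=> Hg /CblockN; exact: CblockD. Qed.

Lemma CblockM g h : H g -> H h -> H (g * h).
Proof.
move=> Hg Hh; split=> [|b Bb].
  by apply: dirgroupM; [exact: CblockG..|exact: Cblock_comm].
by apply/commr_sym/commrM; apply/commr_sym/CblockC.
Qed.

Lemma Cblock_half g : H g -> H (hf * g).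
Proof.
move=> [Gg gB]; split=> [|b Bb]; first exact: dirgroup_half.
by apply/commr_sym/commrM; [exact: half_comm|exact/commr_sym/gB].
Qed.

Lemma Cblock_halfX k g : H g -> H (hf ^+ k * g).
Proof.
move=> Hg; elim: k => [|k IH]; first by rewrite mul1r.
by rewrite exprS -mulrA; exact: Cblock_half.
Qed.

Lemma CblockMn g n : H g -> H (g *+ n).
Proof.
move=> Hg; elim: n => [|n IH]; first by rewrite mulr0n; exact: Cblock0.
by rewrite mulrS; exact: CblockD.
Qed.

Lemma Cblock_eabs h : H h -> H (eabs E h).
Proof.
move=> Hh; have [m_ge0 _ mC] := eabsP (CblockG Hh).
by apply: Cblock_closed mC => //; exact: Eplus_dirgroup.
Qed.

Lemma Cblock_carrier h : H h -> H (carrier E h).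
Proof.
move=> Hh; have [[Gp _] _ pC] := carrierP (CblockG Hh).
exact: Cblock_closed pC.
Qed.

Lemma CblockPM g h : H g -> H h -> P g -> P h -> P (g * h).
Proof. by move=> Hg Hh g_ge0 h_ge0; apply: EplusM => //; exact: Cblock_comm. Qed.

(** * The e-ring structure of a C-block *)

(** Conversely, a positive [a] in [H] is the sum of [2 ^ k] copies of [hf ^+ k * a], an effect in
    [H] once [k] is large. *)
Lemma Eplus_Cblock a : Eplus (E `&` H) a <-> P a /\ H a.
Proof.
split=> [|[a_ge0 Ha]].
  move=> [n [e [eP ->]]]; split.
    by exists n, e; split=> // i; case: (eP i).
  apply: (big_ind H) => [||i _]; [exact: Cblock0|exact: CblockD|].
  by case: (eP i).
have [k ak] := order_unit_half (Eplus_dirgroup a_ge0).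
exists (2 ^ k)%N, (fun=> hf ^+ k * a); split=> [_|].
  split; last exact: Cblock_halfX.
  by apply/effectP; split=> //; exact: Eplus_halfX.
by rewrite sumr_const card_ord halfX_cancel.
Qed.

Lemma dirgroup_Cblock : dirgroup (E `&` H) = H.
Proof.
apply/seteqP; split=> h.
  move=> [a [b [/Eplus_Cblock [_ Ha] /Eplus_Cblock [_ Hb] ->]]].
  exact: CblockB.
move=> Hh; have [n hn] := dirgroup_bound (dirgroupN (CblockG Hh)).
(* This writes [h] as [(n + h) - n]; the double sign comes from bounding [- h]. *)
exists (n%:R - - h), (n%:R); split; last by rewrite opprK addrC addKr.
  apply/Eplus_Cblock; split=> //; apply/CblockB; last exact: CblockN.
  exact/CblockMn/Cblock1.
apply/Eplus_Cblock; split; first exact/EplusMn/Eplus1.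
exact/CblockMn/Cblock1.
Qed.

Lemma projections_Cblock p : projections (E `&` H) p <-> projections E p /\ H p.
Proof.
rewrite /projections /= dirgroup_Cblock; split=> [[Hp pp]|[[_ pp] Hp]] //.
by split=> //; split=> //; exact: CblockG.
Qed.

Lemma eabs_Cblock h : H h -> eabs (E `&` H) h = eabs E h.
Proof.
move=> Hh; have [m_ge0 m2 mC] := eabsP (CblockG Hh); have Hm := Cblock_eabs Hh.
apply: xget_unique => [|t].
  by split; rewrite /ele ?dirgroup_Cblock ?subr0 //; apply/Eplus_Cblock.
case; rewrite /ele dirgroup_Cblock subr0 => Ht /Eplus_Cblock [t_ge0 _] t2.
apply: sqrt_unique => //; last by rewrite t2.
exact: Cblock_comm.
Qed.

(** Complements of projections in [H] stay in [H], so the annihilator within [H] already determines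
    the carrier. *)
Lemma carrier_Cblock h : H h -> carrier (E `&` H) h = carrier E h.
Proof.
move=> Hh; have [Pp pE _] := carrierP (CblockG Hh); have Hp := Cblock_carrier Hh.
set p := carrier E h in Pp pE Hp *.
have H1B q : H q -> H (1 - q) by apply: CblockB; exact: Cblock1.
apply: xget_unique => [|q].
  split; first exact/projections_Cblock.
  by rewrite dirgroup_Cblock => k Hk; apply: pE; exact: CblockG.
case; rewrite dirgroup_Cblock => /projections_Cblock [Pq Hq] qE.
have qp : q * (1 - p) = 0.
  apply/qE; first exact: H1B.
  apply/pE; first exact/CblockG/H1B.
  by rewrite mulrBr mulr1 proj_idem ?subrr.
have pq : p * (1 - q) = 0.
  apply/pE; first exact/CblockG/H1B.
  apply/qE; first exact: H1B.
  by rewrite mulrBr mulr1 proj_idem ?subrr.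
move: qp pq; rewrite !mulrBr !mulr1 => /subr0_eq q_qp /subr0_eq p_pq.
rewrite [LHS]q_qp [RHS]p_pq.
exact: Cblock_comm.
Qed.

(** * Real scalars on a C-block *)

Section Scalars.
Variables (K : realType) (scal : K -> R -> R).
Hypothesis VS : po_real_vector_space G (ele E) scal.

Let LS := porvs_space VS.

Lemma scal_halfE x : G x -> scal 2^-1 x = hf * x.
Proof.
move=> Gx; apply: half_uniq; rewrite -(rvs_scalDl LS) //.
by rewrite -(div1r 2) -splitr (rvs_scal1 LS).
Qed.

Lemma scalG a x : G x -> G (scal a x). Proof. exact: (rvs_closed LS). Qed.

Lemma scal0l x : G x -> scal 0 x = 0.
Proof.
by move=> Gx; apply: (addrI (scal 0 x)); rewrite -(rvs_scalDl LS) // !addr0.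
Qed.

Lemma scalNl a x : G x -> scal (- a) x = - scal a x.
Proof.
move=> Gx; apply/eqP; rewrite -addr_eq0 -(rvs_scalDl LS) //.
by rewrite addNr scal0l.
Qed.

Lemma scalBl a b x : G x -> scal (a - b) x = scal a x - scal b x.
Proof. by move=> Gx; rewrite (rvs_scalDl LS) // scalNl. Qed.

Lemma scalBr a x y : G x -> G y -> scal a (x - y) = scal a x - scal a y.
Proof.
move=> Gx Gy; apply: (addIr (scal a y)).
by rewrite -(rvs_scalDr LS) // ?subrK //; exact: dirgroupB.
Qed.

Lemma scal_nat n x : G x -> scal n%:R x = x *+ n.
Proof.
move=> Gx; elim: n => [|n IH]; first exact: scal0l.
by rewrite -addn1 natrD (rvs_scalDl LS) // (rvs_scal1 LS) // IH mulrnDr.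
Qed.

Lemma scal_ge0 a x : 0 <= a -> P x -> P (scal a x).
Proof.
move=> a_ge0 x_ge0; have Gx := Eplus_dirgroup x_ge0.
by have := porvs_scal_ge0 VS Gx a_ge0; rewrite /ele !subr0; exact.
Qed.

Lemma scal_le a b x : a <= b -> P x -> P (scal b x - scal a x).
Proof.
move=> ab x_ge0; rewrite -scalBl; last exact: Eplus_dirgroup.
by apply: scal_ge0 => //; rewrite subr_ge0.
Qed.

(* scal is not assumed compatible with the product of R; the link is that scal a y
   is squeezed between 0 and an integer multiple of y. *)
Lemma scal_proj_eq0 a q y : projections E q -> P y -> q * y = 0 ->
  q * scal a y = 0 /\ scal a y * q = 0.
Proof.
move=> Pq y_ge0 qy0; have Gy := Eplus_dirgroup y_ge0.
have q_ge0 := Eplus_proj Pq.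
wlog a_ge0 : a / 0 <= a => [hw|].
  have [|/ltW] := leP 0 a; first exact: hw.
  rewrite -oppr_ge0 => /hw; rewrite scalNl // mulrN mulNr.
  by move=> [/eqP + /eqP]; rewrite !oppr_eq0 => /eqP + /eqP.
apply: (ering_v ER) => //; first exact: scal_ge0.
apply: Eplus_anti; first by apply: (ering_iv ER) => //; exact: scal_ge0.
have /truncn_itv /andP[_ /ltW an] := a_ge0.
have := ering_iv ER q_ge0 (scal_le an y_ge0).
by rewrite scal_nat // mulrBr mulrBl mulrnAr qy0 mul0rn mul0r sub0r.
Qed.

(** Cut [x] into the positive pieces [p * x] and [(1 - p) * x]. By [scal_proj_eq0], each piece stays
    annihilated by the opposite projection after scaling. *)
Lemma scal_proj_comm_ge0 a p x : projections E p -> P x -> GRing.comm p x ->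
  GRing.comm p (scal a x).
Proof.
move=> Pp x_ge0 px; have Pp' := proj_compl Pp.
have p'x : GRing.comm (1 - p) x by apply/commr_sym/commrB; [exact: commr1|].
have px_ge0 : P (p * x) by apply: EplusM => //; exact: Eplus_proj.
have p'x_ge0 : P ((1 - p) * x) by apply: EplusM => //; exact: Eplus_proj.
have [u1 u2] : (1 - p) * scal a (p * x) = 0 /\ scal a (p * x) * (1 - p) = 0.
  apply: scal_proj_eq0 => //.
  by rewrite mulrA mulrBl mul1r (proj_idem Pp) subrr mul0r.
have [v1 v2] : p * scal a ((1 - p) * x) = 0 /\ scal a ((1 - p) * x) * p = 0.
  apply: scal_proj_eq0 => //.
  by rewrite mulrA mulrBr mulr1 (proj_idem Pp) subrr mul0r.
have -> : x = p * x + (1 - p) * x by rewrite -mulrDl subrKC mul1r.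
rewrite (rvs_scalDr LS); [|exact: Eplus_dirgroup..].
apply/commrD; last by rewrite /GRing.comm v1 v2.
move: u1 u2; rewrite mulrBl mulrBr mul1r mulr1 => /subr0_eq u1 /subr0_eq u2.
by rewrite /GRing.comm -u1 -u2.
Qed.

(** Writing [x = (x + n) - n] reduces statements additive in [x] to positive elements. *)
Lemma Cblock_shift x : H x -> exists2 n : nat, H (x + n%:R) & P (x + n%:R).
Proof.
move=> Hx; have [n xn] := dirgroup_bound (dirgroupN (CblockG Hx)).
exists n; first by apply: CblockD => //; exact/CblockMn/Cblock1.
by rewrite addrC; move: xn; rewrite opprK.
Qed.

Lemma Cblock_scal a x : H x -> H (scal a x).
Proof.
move=> Hx; have Gx := CblockG Hx; split; first exact: scalG.
move=> b Bb; have [n Hn n_ge0] := Cblock_shift Hx; apply/commr_sym.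
have [Pb _] := blockB.1; have {}Pb := Pb b Bb.
have P_n : P n%:R by exact/EplusMn/Eplus1.
have -> : x = x + n%:R - n%:R by rewrite addrK.
rewrite scalBr; [|exact: Eplus_dirgroup..].
apply/commrB; apply: scal_proj_comm_ge0 => //; last exact: commr_nat.
exact/commr_sym/CblockC.
Qed.

(** For [t = n * a] between [m] and [m + 1], both [scal t x * y] and [scal t (x * y)] lie between
    [m] and [m + 1] times [x * y]. So all multiples of the defect [z] and of [- z] are at most
    [x * y], and the archimedean property gives [z = 0]. *)
Lemma scal_mul_ge0 a x y : 0 <= a -> H x -> H y -> P x -> P y ->
  scal a x * y = scal a (x * y).
Proof.
move=> a_ge0 Hx Hy x_ge0 y_ge0.
have [Gx Gy] := (CblockG Hx, CblockG Hy).
have Hxy := CblockM Hx Hy; have Gxy := CblockG Hxy.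
have xy_ge0 : P (x * y) by exact: CblockPM.
set z := scal a x * y - scal a (x * y).
have Gz : G z.
  apply/CblockG/CblockB; last exact: Cblock_scal.
  by apply: CblockM => //; exact: Cblock_scal.
have bounds n : P (x * y - z *+ n) /\ P (x * y - (- z) *+ n).
  pose t := n%:R * a.
  have zn : z *+ n = scal t x * y - scal t (x * y).
    by rewrite /t -!(rvs_scalA LS) // !scal_nat ?mulrnBl ?mulrnAl //; exact: scalG.
  have /truncn_itv /andP[mt /ltW tm] : 0 <= t by rewrite mulr_ge0.
  move: (Num.truncn t) mt tm => m mt tm.
  have Pm w : P w -> P (scal t w - w *+ m).
    by move=> w_ge0; rewrite -scal_nat; [exact: scal_le|exact: Eplus_dirgroup].
  have Pm1 w : P w -> P (w *+ m.+1 - scal t w).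
    by move=> w_ge0; rewrite -scal_nat; [exact: scal_le|exact: Eplus_dirgroup].
  have Ht w : H w -> H (scal t w) by exact: Cblock_scal.
  split.
    have Hw := CblockB (CblockMn m.+1 Hx) (Ht x Hx).
    have := EplusD (CblockPM Hw Hy (Pm1 x x_ge0) y_ge0) (Pm _ xy_ge0).
    move=> /Eplus_eq; apply; rewrite zn mulrBl mulrnAl mulrS; ncring.
  have Hw := CblockB (Ht x Hx) (CblockMn m Hx).
  have := EplusD (CblockPM Hw Hy (Pm x x_ge0) y_ge0) (Pm1 _ xy_ge0).
  move=> /Eplus_eq; apply; rewrite mulNrn zn mulrBl mulrnAl mulrS; ncring.
apply: subr0_eq; apply: Eplus_anti.
  have := @archimedean_dirgroup (- z) (x * y) (dirgroupN Gz) Gxy.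
  by rewrite /ele sub0r opprK; apply=> n _; case: (bounds n).
have := @archimedean_dirgroup z (x * y) Gz Gxy.
by rewrite /ele sub0r; apply=> n _; case: (bounds n).
Qed.

Lemma scal_mulAl a x y : H x -> H y -> scal a x * y = scal a (x * y).
Proof.
move=> Hx Hy; have [Gx Gxy] := (CblockG Hx, CblockG (CblockM Hx Hy)).
wlog a_ge0 : a / 0 <= a => [hw|].
  have [|/ltW] := leP 0 a; first exact: hw.
  rewrite -oppr_ge0 => /hw; by rewrite !scalNl // mulNr => /oppr_inj.
have Hnat n : H n%:R by exact/CblockMn/Cblock1.
have Pnat n : P n%:R by exact/EplusMn/Eplus1.
have Gpair u v : H u -> H v -> G (u * v) by move=> Hu Hv; exact/CblockG/CblockM.
have mul_ge0 w : H w -> P w -> scal a x * w = scal a (x * w).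
  move=> Hw w_ge0; have [n Hn n_ge0] := Cblock_shift Hx.
  have {1 2}-> : x = x + n%:R - n%:R by rewrite addrK.
  rewrite scalBr; [|exact: Eplus_dirgroup..].
  rewrite !mulrBl scalBr; [|exact: Gpair..].
  by rewrite !scal_mul_ge0.
have [n Hn n_ge0] := Cblock_shift Hy.
have {1 2}-> : y = y + n%:R - n%:R by rewrite addrK.
rewrite !mulrBr scalBr; [|exact: Gpair..].
by rewrite !mul_ge0.
Qed.

(** * Lattice operations in a C-block *)

Lemma eposE g : G g -> epos scal E g = hf * (eabs E g + g).
Proof.
move=> Gg; apply/scal_halfE/dirgroupD => //.
by have [m_ge0 _ _] := eabsP Gg; exact: Eplus_dirgroup.
Qed.

Lemma Cblock_epos h : H h -> H (epos scal E h).
Proof.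
by move=> Hh; apply/Cblock_scal/CblockD => //; exact: Cblock_eabs.
Qed.

Lemma Cblock_eneg h : H h -> H (eneg scal E h).
Proof.
by move=> Hh; apply/Cblock_scal/CblockB => //; exact: Cblock_eabs.
Qed.

(** The positive part is the join of 0 and [w] in [H]. Leastness follows from splitting [z - p * w]
    as [p * (z - w) + (1 - p) * z], where both products are positive because [H] is commutative. *)
Lemma Cblock_epos_lub w : H w -> [/\ P (epos scal E w), P (epos scal E w - w) &
  forall z, H z -> P z -> P (z - w) -> P (z - epos scal E w)].
Proof.
move=> Hw; have Gw := CblockG Hw; have [m_ge0 m2 mC] := eabsP Gw.
have [p [Pp pos neg pw pC]] := pos_part_proj Gw m_ge0 m2 (mC w Gw (erefl _)).
have Hp : H p.
  apply: (Cblock_closed Hw); first by case: Pp.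
  by move=> c Gc cw; apply: pC => //; exact: mC.
rewrite eposE //; split=> // [|z Hz z_ge0 wz].
  apply: Eplus_eq neg _.
  by transitivity (hf * (eabs E w + w) - (hf * w + hf * w)); [ncring|rewrite halfD].
have Hp' : H (1 - p) by apply: CblockB => //; exact: Cblock1.
have := EplusD (CblockPM Hp (CblockB Hz Hw) (Eplus_proj Pp) wz)
  (CblockPM Hp' Hz (Eplus_proj (proj_compl Pp)) z_ge0).
by move=> /Eplus_eq; apply; rewrite -pw; ncring.
Qed.

Lemma Cblock_join g h : H g -> H h ->
  sup_in H (ele E) [set g; h] (g + epos scal E (h - g)).
Proof.
move=> Hg Hh; have Hw := CblockB Hh Hg.
have [pos ub lub] := Cblock_epos_lub Hw.
split=> [|s [->|->]|y Hy yub].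
- by apply: CblockD => //; exact: Cblock_epos.
- by rewrite /ele addrC addKr.
- by rewrite /ele; apply: Eplus_eq ub _; ncring.
- have gy : P (y - g) by apply: yub; left.
  have hy : P (y - h) by apply: yub; right.
  rewrite /ele opprD addrA; apply: lub => //; first exact: CblockB.
  by apply: Eplus_eq hy _; ncring.
Qed.

Lemma Cblock_meet g h : H g -> H h ->
  inf_in H (ele E) [set g; h] (g - epos scal E (g - h)).
Proof.
move=> Hg Hh; have Hw := CblockB Hg Hh.
have [pos ub lub] := Cblock_epos_lub Hw.
split=> [|s [->|->]|y Hy ylb].
- by apply: CblockB => //; exact: Cblock_epos.
- by rewrite /ele opprB addrC subrK.
- by rewrite /ele; apply: Eplus_eq ub _; ncring.
- have yg : P (g - y) by apply: ylb; left.
  have yh : P (h - y) by apply: ylb; right.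
  rewrite /ele addrAC; apply: lub => //; first exact: CblockB.
  by apply: Eplus_eq yh _; ncring.
Qed.

(** * Countable suprema and the assembled structure *)

(** Running joins turn [e] into an ascending sequence with the same upper bounds in [H]. Its
    supremum in [G] commutes with [B], as the joins do, and so lies in [H]. *)
Lemma Cblock_seq_sup (e : nat -> R) : (forall n, H (e n)) ->
  (exists2 b, H b & forall n, P (b - e n)) -> exists x, sup_in H (ele E) (range e) x.
Proof.
move=> He [b Hb eb].
pose u := fix u n := if n is m.+1 then u m + epos scal E (e m.+1 - u m) else e 0%N.
have Hu n : H (u n).
  elim: n => [|n IH] /=; first exact: He.
  by case: (Cblock_join IH (He n.+1)).
have uP n := Cblock_join (Hu n) (He n.+1).
have u_incr n : P (u n.+1 - u n) by have [_ ub _] := uP n; apply: ub; left.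
have eu n : P (u n - e n).
  case: n => [|n]; first by rewrite subrr; exact: Eplus0.
  by have [_ ub _] := uP n; apply: ub; right.
have u_le y : H y -> (forall n, P (y - e n)) -> forall n, P (y - u n).
  move=> Hy ye; elim=> [|n IH]; first exact: ye.
  by have [_ _ lub] := uP n; apply: lub => // s [->|->]; rewrite /ele.
have [n|m n||s [Gs us s_min sC]] := @vigier_sup u _ u_incr.
- exact: CblockG.
- exact: Cblock_comm.
- by exists b; [exact: CblockG|exact: u_le].
exists s; split=> [|_ [n _ <-]|y Hy ye].
- split=> // c Bc; apply: sC => [|n]; first exact/CblockG/block_sub_Cblock.
  exact/commr_sym/CblockC.
- exact: Eplus_trans (eu n) (us n).
- by apply: s_min => [|]; [exact: CblockG|apply: u_le => // n; apply: ye; exists n].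
Qed.

Lemma Cblock_sigma_complete : dedekind_sigma_complete H (ele E).
Proof.
split=> S SH [s0 Ss0] /pfcard_geP [S0|]; first by rewrite S0 in Ss0.
- move=> /surjfunPex [e Se] [b Hb Sb]; rewrite Se; apply: Cblock_seq_sup => [n|].
    by apply: SH; rewrite Se; exists n.
  by exists b => // n; apply: Sb; rewrite Se; exists n.
- by rewrite S0 in Ss0.
move=> /surjfunPex [e Se] [b Hb Sb].
have Se' n : S (e n) by rewrite Se; exists n.
(* The infimum is minus the supremum of the negated sequence. *)
have [n||x [Hx xub x_lub]] := @Cblock_seq_sup (fun n => - e n).
- exact/CblockN/SH.
- exists (- b) => [|n]; first exact: CblockN.
  by apply: Eplus_eq (Sb _ (Se' n)) _; ncring.
exists (- x); split=> [|s|y Hy yS]; first exact: CblockN.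
  rewrite Se => -[n _ <-]; have : ele E (- e n) x by apply: xub; exists n.
  by move=> h; apply: Eplus_eq h _; ncring.
have : ele E x (- y).
  apply: x_lub => [|_ [n _ <-]]; first exact: CblockN.
  by apply: Eplus_eq (yS _ (Se' n)) _; ncring.
by move=> h; apply: Eplus_eq h _; ncring.
Qed.

Lemma Cblock_l_algebra : l_algebra H (ele E) scal.
Proof.
have HG := CblockG.
have Hgrp : additive_subgroup H by split; [exact: Cblock0|exact: CblockB].
have space : real_vector_space H scal.
  split=> //.
  - exact: Cblock_scal.
  - by move=> a b x /HG; exact: (rvs_scalA LS).
  - by move=> x /HG; exact: (rvs_scal1 LS).
  - by move=> a x y /HG Gx /HG; exact: (rvs_scalDr LS).
  - by move=> a b x /HG; exact: (rvs_scalDl LS).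
have mulAl := scal_mulAl.
split; last first.
  move=> x y Hx Hy; split.
    by exists (x + epos scal E (y - x)); exact: Cblock_join.
  by exists (x - epos scal E (x - y)); exact: Cblock_meet.
split.
- split=> //; [exact: Cblock1|exact: CblockM|].
  move=> a x y Hx Hy; rewrite (Cblock_comm Hx); last exact: Cblock_scal.
  by rewrite mulAl // (Cblock_comm Hx).
- split=> //; last by move=> a x /HG; exact: (porvs_scal_ge0 VS).
  have [_ refl anti trans add] := porvs_group VS.
  split=> //.
  + by move=> x /HG; exact: refl.
  + by move=> x y /HG Gx /HG; exact: anti.
  + by move=> x y z /HG Gx /HG Gy /HG; exact: trans.
  + by move=> x y z /HG Gx /HG Gy /HG; exact: add.
- by move=> x y Hx Hy; rewrite /ele !subr0; exact: CblockPM.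
Qed.

Lemma spectral_Cblock h l : H h ->
  spectral_resolution scal (E `&` H) h l = spectral_resolution scal E h l /\
  eigenprojections scal (E `&` H) h l = eigenprojections scal E h l.
Proof.
move=> Hh; have Hhl : H (h - scal l 1).
  by apply: CblockB => //; exact/Cblock_scal/Cblock1.
(* Only the [epos] calculated in [H] is unfolded; once its absolute value is replaced, it agrees
   with the one in [G] by conversion. *)
rewrite /spectral_resolution /eigenprojections {1}/epos eabs_Cblock //.
by rewrite !carrier_Cblock //; exact: Cblock_epos.
Qed.

End Scalars.
End CBlock.
End AHTheory.
End Half.
End ERingTheory.

Theorem theorem8p4 (K : realType) (R : nzRingType) (E : set R)
    (scal : K -> R -> R) (H : set R)
    (ER : e_ring E) (AH : AH_algebra E)
    (VS : po_real_vector_space (dirgroup E) (ele E) scal)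
    (HC : C_block E H) :
  [/\ forall h, H h ->
        [/\ H (eabs E h), H (epos scal E h), H (eneg scal E h)
          & H (carrier E h)],
      [/\ l_algebra H (ele E) scal, archimedean H (ele E),
          dedekind_sigma_complete H (ele E) & order_unit H (ele E) 1],
      forall g h, H g -> H h ->
        inf_in H (ele E) [set g; h] (g - epos scal E (g - h)) /\
        sup_in H (ele E) [set g; h] (g + epos scal E (h - g))
    & forall h, H h -> forall l : K,
        spectral_resolution scal (E `&` H) h l = spectral_resolution scal E h l /\
        eigenprojections scal (E `&` H) h l = eigenprojections scal E h l].
Proof.
case: AH => -[hf Ehf hfD] QA CV; case: HC => B [blockB ->].
split.
- move=> h Hh; split.
  + exact: (Cblock_eabs ER Ehf hfD QA CV blockB).
  + exact: (Cblock_epos ER Ehf hfD QA CV blockB VS).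
  + exact: (Cblock_eneg ER Ehf hfD QA CV blockB VS).
  + exact: (Cblock_carrier ER Ehf hfD QA CV blockB).
- split.
  + exact: (Cblock_l_algebra ER Ehf hfD QA CV blockB VS).
  + move=> g h [Gg _] [Gh _].
    exact: (archimedean_dirgroup ER Ehf hfD CV Gg Gh).
  + exact: (Cblock_sigma_complete ER Ehf hfD QA CV blockB VS).
  + split=> [|g [Gg _]]; first exact: Cblock1.
    (* The successor is taken because the bound may be 0, while an order unit asks for a positive
       multiple. *)
    have [n gn] := dirgroup_bound ER Gg; exists n.+1 => //.
    rewrite /ele mulrS -addrA; apply: EplusD => //; exact: Eplus1.
- move=> g h Hg Hh; split.
  + exact: (Cblock_meet ER Ehf hfD QA CV blockB VS Hg Hh).
  + exact: (Cblock_join ER Ehf hfD QA CV blockB VS Hg Hh).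
- by move=> h Hh l; exact: (spectral_Cblock ER Ehf hfD QA CV blockB VS l Hh).
Qed.
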